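(* Let $p$ be a prime, let $k \geq 1$, and let $n \geq 0$ with standard base-$p$ representation $n_\ell \cdots n_1 n_0$. Define \[ T_{p, k}(n, x) = \sum_{\substack{\mathbf{m} \in \mathbb{N}^k \\ m_1+\cdots+m_k = n}} x^{\nu_p\left(\frac{n!}{m_1!\, m_2! \cdots m_k!}\right)}. \] For each $d \in \{0, 1, \dots, p - 1\}$ let $M_{p, k}(d)$ be the $k \times k$ matrix whose $(i, j)$ entry (for $1 \le i,j \le k$) is $c_{p, k}(p (j - 1) + d - (i - 1)) \, x^{i - 1}$. Let $e = \begin{bmatrix} 1 & 0 & \cdots & 0 \end{bmatrix}$ be the first standard basis row vector of length $k$. Then \[ T_{p, k}(n, x) = e \, M_{p, k}(n_0) \, M_{p, k}(n_1) \, \cdots \, M_{p, k}(n_\ell) \, e^\top. \]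
   Context: $\mathbb{N}$ denotes the set of non-negative integers, and $\mathbf{m} = (m_1,\dots,m_k)$. $\nu_p(N)$ denotes the $p$-adic valuation of a positive integer $N$. For an integer $r$ (possibly negative), $c_{p, k}(r)$ is the number of $k$-tuples $(d_1,\dots,d_k) \in \{0, 1, \dots, p - 1\}^k$ with $d_1+\cdots+d_k = r$; equivalently, the coefficient of $x^r$ in $(1 + x + \cdots + x^{p-1})^k$ (in particular $c_{p,k}(r) = 0$ for $r < 0$). *)

(* Defs.v *)
From HB Require Import structures.
From mathcomp Require Import all_boot all_order all_algebra.

Set Implicit Arguments.
Unset Strict Implicit.
Unset Printing Implicit Defensive.

Import GRing.Theory.
Local Open Scope ring_scope.

(* The digit d_i is indexed by increasing weight p ^ i. The last condition
   forbids leading zeros; 0 is represented by the single digit 0. *)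
Definition standard_repr (p n l : nat) (d : 'I_l.+1 -> 'I_p) : Prop :=
  n = (\sum_(i < l.+1) d i * p ^ i)%N /\
  ((0 < l)%N -> (d ord_max : nat) <> 0%N).

Definition multinom (n k : nat) (m : 'I_k -> nat) : nat :=
  (n`! %/ \prod_(i < k) (m i)`!)%N.

(* Each part of a k-tuple of naturals with sum n is at most n, so the sum over
   N^k is taken over functions into 'I_n.+1. *)
Definition T (p k n : nat) : {poly int} :=
  \sum_(m : {ffun 'I_k -> 'I_n.+1} | (\sum_(i < k) m i == n)%N)
    'X^(logn p (multinom n (fun i => m i : nat))).

Definition c (p k : nat) (r : int) : nat :=
  #|[set d : {ffun 'I_k -> 'I_p} | (\sum_(i < k) d i)%N%:Z == r]|.

(* Indices start at 0, so i and j here are the usual i - 1 and j - 1. *)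
Definition M (p k : nat) (d : 'I_p) : 'M[{poly int}]_k :=
  \matrix_(i < k, j < k)
    ((c p k (p%:Z * j%:Z + d%:Z - i%:Z))%:R * 'X^i).

Definition e (k : nat) : 'rV[{poly int}]_k :=
  \row_(j < k) ((j : nat) == 0%N)%:R.

(* Main.v *)
Require Import Defs.
From HB Require Import structures.
From mathcomp Require Import all_boot all_order all_algebra.
From mathcomp Require Import zify.

Import GRing.Theory.
Local Open Scope ring_scope.

(** Legendre's formula in the recursive form
    [nu_p(n!) = n / p + nu_p((n / p)!)] shows that removing the last base-[p]
    digits [r] from [m_1, ..., m_k] and [n] lowers
    [nu_p(n!) - sum_a nu_p(m_a!)] exactly by the carry [j] that the digits
    produce.  If [i] is the incoming carry and [d] the last digit of [n], then
    [sum_a r_a + i = p j + d], which has [c(p j + d - i)] solutions [r].  Hence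
    the generating functions [carry_gf] of the tuples with
    [m_1 + ... + m_k + i = n] satisfy a linear recursion in [n] with transition
    matrix [M d]. *)

Lemma logn_fact_rec (p n : nat) : prime p ->
  logn p n`! = (n %/ p + logn p (n %/ p)`!)%N.
Proof.
move=> hp; have p1 := prime_gt1 hp.
case: n => [|n]; first by rewrite div0n logn1.
rewrite !logn_fact // big_nat_recl // expn1; congr addn.
under eq_bigr => i _ do rewrite expnS divnMA.
have le_q : (n.+1 %/ p <= n)%N by rewrite -ltnS ltn_Pdiv.
set q := (n.+1 %/ p)%N in le_q *.
(* Legendre's sum for [q]! stops at [i = q]. The terms with [q < i <= n] vanish because [q < p ^ i],
   so both sums can share one range. *)
rewrite [RHS](_ : _ = \sum_(1 <= i < n.+1) q %/ p ^ i)%N; last first.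
  rewrite [RHS](big_cat_nat (n := q.+1)) //= [X in (_ + X)%N]big_nat_cond.
  rewrite [X in (_ + X)%N]big1 ?addn0 // => i /andP[/andP[lt_qi _] _].
  by rewrite divn_small // (leq_trans lt_qi) // ltnW // ltn_expl.
by [].
Qed.

Lemma dvdn_prod_fact_sum (I : finType) (m : I -> nat) :
  (\prod_i (m i)`! %| (\sum_i m i)`!)%N.
Proof.
elim/big_rec2: _ => // i s t _ h.
apply: dvdn_trans (dvdn_mul (dvdnn _) h) _.
by rewrite -(bin_fact (leq_addr s (m i))) addKn dvdn_mull.
Qed.

Lemma dvdn_prod_fact (I : finType) (m : I -> nat) (n : nat) :
  (\sum_i m i <= n)%N -> (\prod_i (m i)`! %| n`!)%N.
Proof.
move=> h; apply: dvdn_trans (dvdn_prod_fact_sum _ m) _.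
by rewrite -(bin_fact h) [X in (_ %| X)%N]mulnCA dvdn_mulr.
Qed.

Lemma logn_prod_fact (p : nat) (I : finType) (m : I -> nat) :
  logn p (\prod_i (m i)`!) = (\sum_i logn p (m i)`!)%N.
Proof.
(* Additivity of the valuation needs nonzero factors, so positivity of the product is carried
   through the induction. *)
suff [] : logn p (\prod_i (m i)`!) = (\sum_i logn p (m i)`!)%N
          /\ (0 < \prod_i (m i)`!)%N by [].
elim/big_rec2: _ => [|i s t _ [<- t0]]; first by rewrite logn1.
by rewrite lognM ?fact_gt0 // muln_gt0 fact_gt0.
Qed.

Lemma logn_multinom (p n k : nat) (m : 'I_k -> nat) :
  (\sum_i m i <= n)%N ->
  logn p (multinom n m) = (logn p n`! - \sum_i logn p (m i)`!)%N.
Proof. by move=> h; rewrite logn_div ?dvdn_prod_fact // logn_prod_fact. Qed.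

(** Ensures that the truncated subtraction in the exponents of [carry_gf] is a true difference. *)
Lemma sum_logn_fact_le (p n : nat) (I : finType) (m : I -> nat) :
  (\sum_i m i <= n)%N -> (\sum_i logn p (m i)`! <= logn p n`!)%N.
Proof.
by move=> h; rewrite -logn_prod_fact dvdn_leq_log ?fact_gt0 ?dvdn_prod_fact.
Qed.

(* [B] only bounds the range of the parts; it is immaterial once [n < B]. *)
Definition carry_gf (p k B i n : nat) : {poly int} :=
  \sum_(m : {ffun 'I_k -> 'I_B} | (\sum_a m a + i == n)%N)
    'X^(i + (logn p n`! - \sum_a logn p (m a)`!)).

Lemma T_carry_gf (p k B n : nat) : (n < B)%N -> T p k n = carry_gf p k B 0 n.
Proof.
move=> lt_nB; rewrite /T /carry_gf.
pose h (m : {ffun 'I_k -> 'I_n.+1}) : {ffun 'I_k -> 'I_B} :=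
  [ffun a => widen_ord lt_nB (m a)].
pose g (m : {ffun 'I_k -> 'I_B}) : {ffun 'I_k -> 'I_n.+1} :=
  [ffun a => inord (m a)].
rewrite (reindex_onto h g) => [|m]; last first.
  rewrite addn0 => /eqP sum_m; apply/ffunP => a; apply: val_inj.
  by rewrite !ffunE /= inordK // ltnS -sum_m (bigD1 a) //= leq_addr.
have sumh (F : nat -> nat) (m : {ffun 'I_k -> 'I_n.+1}) :
    (\sum_a F (h m a) = \sum_a F (m a))%N.
  by apply: eq_bigr => a _; rewrite ffunE.
apply: eq_big => [m | m /eqP sum_m].
  rewrite addn0 (sumh id); case: eqP => //= _; apply/esym/eqP/ffunP => a.
  by apply: val_inj; rewrite !ffunE /= inordK.
by rewrite logn_multinom ?sum_m // (sumh (fun x => logn p x`!)).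
Qed.

Lemma append_digit_subproof (p B : nat) (r : 'I_p) (q : 'I_B) : (r + p * q < p * B)%N.
Proof.
by apply: (@leq_trans (p * q.+1)); rewrite ?leq_mul // mulnS ltn_add2r.
Qed.

Lemma quotient_subproof (p B : nat) (p_gt0 : (0 < p)%N) (m : 'I_(p * B)) : (m %/ p < B)%N.
Proof. by rewrite ltn_divLR // [X in (_ < X)%N]mulnC. Qed.

(** The bound [p * B] makes [m = r + p * q] an exact bijection, with inverse [split_digit]. *)
Definition append_digit (p k B : nat)
    (x : {ffun 'I_k -> 'I_p} * {ffun 'I_k -> 'I_B}) :
    {ffun 'I_k -> 'I_(p * B)} :=
  [ffun a => Ordinal (append_digit_subproof _ _ (x.1 a) (x.2 a))].

Definition split_digit (p k B : nat) (p_gt0 : (0 < p)%N)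
    (m : {ffun 'I_k -> 'I_(p * B)}) :
    {ffun 'I_k -> 'I_p} * {ffun 'I_k -> 'I_B} :=
  ([ffun a => Ordinal (ltn_pmod (m a) p_gt0)],
   [ffun a => Ordinal (quotient_subproof _ _ p_gt0 (m a))]).

Lemma append_digitK (p k B : nat) (p_gt0 : (0 < p)%N) :
  cancel (append_digit p k B) (split_digit p k B p_gt0).
Proof.
case=> r q; congr pair; apply/ffunP => a; apply: val_inj; rewrite !ffunE /=.
  by rewrite addnC mulnC modnMDl modn_small.
by rewrite addnC mulnC divnMDl // divn_small // addn0.
Qed.

Lemma split_digitK (p k B : nat) (p_gt0 : (0 < p)%N) :
  cancel (split_digit p k B p_gt0) (append_digit p k B).
Proof.
move=> m; apply/ffunP => a; apply: val_inj; rewrite !ffunE /=.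
by rewrite addnC [in LHS]mulnC -divn_eq.
Qed.

(** The digits and the incoming carry total at most [k * (p - 1) + (k - 1) < p * k]. Carries thus
    stay among the [k] indices of the matrix. *)
Lemma carry_lt (p k d i j : nat) (r : 'I_k -> 'I_p) :
  (i < k)%N -> (\sum_a r a + i = p * j + d)%N -> (j < k)%N.
Proof.
move=> lt_ik eq_r.
have le_r : (\sum_a r a <= k * p.-1)%N.
  rewrite -[k in (k * _)%N]card_ord -sum_nat_const; apply: leq_sum => a _.
  by case: (r a) => x /=; lia.
have p_gt0 : (0 < p)%N := leq_ltn_trans (leq0n _) (ltn_ord (r (Ordinal lt_ik))).
have eq_kp : (k * p.-1 + k = p * k)%N by rewrite -mulnSr prednK // mulnC.
by rewrite ltnNge; apply/negP => le_kj; have := leq_mul (leqnn p) le_kj; lia.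
Qed.

Lemma carry_gf_rec (p k B i n d : nat) : prime p -> (i < k)%N -> (d < p)%N ->
  carry_gf p k (p * B) i (d + p * n) =
  \sum_(j < k) ((c p k (p%:Z * j%:Z + d%:Z - i%:Z))%:R * 'X^i)
                * carry_gf p k B j n.
Proof.
move=> hp lt_ik lt_dp; have p0 := prime_gt0 hp.
have divE x y : (x < p)%N -> ((x + p * y) %/ p = y)%N.
  by move=> lt_xp; rewrite addnC mulnC divnMDl // divn_small // addn0.
(* Moving [i] to the other side turns the possibly negative target into an equation between
   naturals. *)
have cE j : (c p k (p%:Z * j%:Z + d%:Z - i%:Z))%:R =
    \sum_(r : {ffun 'I_k -> 'I_p})
      ((\sum_a r a + i == p * j + d)%N)%:R :> {poly int}.
  rewrite /c -sum1_card natr_sum big_mkcond /=; apply: eq_bigr => r _.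
  rewrite inE; set s := (\sum_a r a)%N.
  by rewrite (_ : (s%:Z == _) = (s + i == p * j + d)%N);
    [case: eqP | apply/eqP/eqP; lia].
under eq_bigr => j _ do rewrite cE !mulr_suml.
rewrite exchange_big /=.
rewrite {1}/carry_gf (reindex (@append_digit p k B)) /=; last first.
  by exists (@split_digit p k B p0) => x _; rewrite ?append_digitK ?split_digitK.
rewrite big_mkcond /= -(pair_bigA _ (fun r q =>
  if (\sum_a append_digit _ _ _ (r, q) a + i == d + p * n)%N
  then 'X^(i + (logn p (d + p * n)`!
                - \sum_a logn p (append_digit _ _ _ (r, q) a)`!))
  else 0)) /=.
apply: eq_bigr => r _.
rewrite /carry_gf.
under [RHS]eq_bigr => j _ do rewrite [X in _ * X]big_mkcond mulr_sumr.
rewrite exchange_big /=; apply: eq_bigr => q _.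
have -> : (\sum_a append_digit p k B (r, q) a =
           \sum_a r a + p * \sum_a q a)%N.
  by rewrite big_distrr -big_split; apply: eq_bigr => a _; rewrite ffunE.
have -> : (\sum_a logn p (append_digit p k B (r, q) a)`! =
           \sum_a q a + \sum_a logn p (q a)`!)%N.
  rewrite -big_split; apply: eq_bigr => a _; rewrite ffunE /= logn_fact_rec //.
  by rewrite divE.
rewrite logn_fact_rec // divE //.
have le_q := @sum_logn_fact_le p n _ (fun a => nat_of_ord (q a)).
move: (\sum_a logn p (q a)`!)%N le_q => v; move: (\sum_a q a)%N => Q le_v.
have lt_carry j := @carry_lt p k d i j r lt_ik.
move: (\sum_a r a)%N lt_carry => S lt_carry.
(* For fixed [r] and [q], at most one carry [j] contributes. If the sum condition on the left fails,
   no [j] satisfies both conditions on the right. *)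
case: eqP => [eq_n | ne_n]; last first.
  rewrite big1 // => j _; case: eqP => [e1|]; last by rewrite !mul0r.
  case: eqP => [e2|]; last by rewrite mulr0.
  by case: ne_n; rewrite -e2 mulnDr; lia.
(* Since [d < p], having [Q > n] would make [p * Q] exceed [d + p * n]. The outgoing carry is
   therefore [j = n - Q]. *)
have le_Qn : (Q <= n)%N.
  by rewrite leqNgt; apply/negP => lt_nQ; have := leq_mul (leqnn p) lt_nQ;
    rewrite mulnS; lia.
have eq_r : (S + i = p * (n - Q) + d)%N.
  by have := leq_mul (leqnn p) le_Qn; rewrite mulnBr; lia.
have lt_jk := lt_carry _ eq_r.
rewrite (bigD1 (Ordinal lt_jk)) //= eq_r eqxx mul1r subnKC // eqxx -exprD.
rewrite big1 ?addr0 => [|j ne_j].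
  (* The terms [n] and [Q] from Legendre's recursion leave exactly [n - Q = j] in the exponent. *)
  by congr 'X^_; have := le_v le_Qn; lia.
case: (Q + j =P n)%N => [eq_j|]; last by rewrite mulr0.
by case/eqP: ne_j; apply: val_inj => /=; lia.
Qed.

Lemma carry_gf_0 (p k i : nat) : carry_gf p k 1 i 0 = (i == 0%N)%:R.
Proof.
rewrite /carry_gf (eq_bigl (fun=> i == 0%N)) => [|m]; last first.
  by rewrite big1 // => a _; rewrite ord1.
case: eqP => [-> | _]; last by rewrite big_pred0.
rewrite (big_pred1 [ffun=> ord0]) => [|m]; first by rewrite fact0 logn1 sub0n expr0.
by apply/esym/eqP/ffunP => a; rewrite !ord1.
Qed.

(** Each step peels off the lowest digit, and the bound [p ^ l] shrinks by a factor [p] along with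
    it. With no digits left, only carry 0 survives, which gives the column [(e k)^T]. *)
Lemma carry_gf_digits (p k l : nat) (d : 'I_l -> 'I_p) (i : 'I_k) : prime p ->
  carry_gf p k (p ^ l) i (\sum_(a < l) d a * p ^ a) =
  ((\prod_(a < l) M k (d a)) *m (e k)^T) i 0.
Proof.
move=> hp; elim: l d i => [|l IHl] d i.
  by rewrite !big_ord0 mul1mx !mxE carry_gf_0.
rewrite !big_ord_recl expn0 muln1 expnS.
have -> : (\sum_(a < l) d (lift ord0 a) * p ^ bump 0 a =
           p * \sum_(a < l) d (lift ord0 a) * p ^ a)%N.
  rewrite big_distrr; apply: eq_bigr => a _.
  by rewrite /bump /= add1n expnS mulnCA.
rewrite carry_gf_rec // -mulmxE -mulmxA [RHS]mxE.
by apply: eq_bigr => j _; rewrite -IHl [M _ _ _ _]mxE.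
Qed.

Theorem theorem3 (p k n l : nat) (d : 'I_l.+1 -> 'I_p)
    (hp : prime p) (hk : (1 <= k)%N) (hd : standard_repr n d) :
  T p k n = (e k *m (\prod_(i < l.+1) M k (d i)) *m (e k)^T) 0 0.
Proof.
case: hd => n_eq _.
(* A number with [L] base-[p] digits is below [p ^ L], so [p ^ l.+1] is a large enough bound on the
   parts. *)
have lt_n (L : nat) (f : 'I_L -> 'I_p) : (\sum_(i < L) f i * p ^ i < p ^ L)%N.
  elim: L f => [|L IHL] f; first by rewrite big_ord0.
  rewrite big_ord_recr /= expnS -[X in (_ < X * _)%N](prednK (prime_gt0 hp)).
  rewrite mulSn -addSn; apply: leq_add.
    exact: (IHL (fun i => f (widen_ord (leqnSn L) i))).
  by rewrite leq_mul // -ltnS prednK ?prime_gt0.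
rewrite (T_carry_gf _ _ (p ^ l.+1)) n_eq ?lt_n //.
rewrite (carry_gf_digits _ _ _ _ (Ordinal hk)) // -mulmxA [RHS]mxE.
(* Multiplying by the row [e k] selects the entry of initial carry 0. *)
move: (_ *m (e k)^T) => w.
rewrite (bigD1 (Ordinal hk)) //= big1 => [|j ne_j]; last first.
  by rewrite [e k _ _]mxE (negPf (_ : (j : nat) != 0%N)) ?mul0r.
by rewrite addr0 [e k _ _]mxE mul1r.
Qed.
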